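(* Let $Q$ be a valued cluster quiver with vertex set $Q_0=\{1,\dots,n\}$ and adjacency matrix $A(Q)$. Then the following statements are equivalent: (i) $Q$ is acyclic; (ii) all principal minors of $A(Q)$ are zero; (iii) all eigenvalues of $A(Q)$ are zero.
   Context: A valued cluster quiver $(Q,v)$ (written $Q$) is a finite quiver (oriented graph with vertex set $Q_0$ and arrow set $Q_1$) without loops and with at most one arrow between any pair of vertices (so in particular no oriented 2-cycles), together with a map $v:Q_1\to\mathbb{Z}_{>0}^2$, $v(\alpha)=(v(\alpha)_1,v(\alpha)_2)$, for which there is a map $d:Q_0\to\mathbb{Z}_{>0}$ such that $d(i)v(\alpha)_1=d(j)v(\alpha)_2$ for each arrow $\alpha:i\to j$. For an arrow $\alpha:i\to j$ write $v_{ij}=v(\alpha)_1$, $v_{ji}=v(\alpha)_2$. The exchange matrix $B(Q)=(b_{ij})_{n\times n}$ is defined by $b_{ij}=v_{ij}$ if there is an arrow $i\to j$, $b_{ij}=-v_{ij}$ if there is an arrow $j\to i$, and $b_{ij}=0$ otherwise. The adjacency matrix is $A(Q)=(\max\{b_{ij},0\})_{n\times n}$. A $k$-cycle is an oriented path of $k$ arrows ending at the vertex where it starts; $Q$ is acyclic if it has no $k$-cycle for any $k\ge 1$. *)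

(* Defs.v *)
From mathcomp Require Import all_boot all_order all_algebra.

Set Implicit Arguments.
Unset Strict Implicit.
Unset Printing Implicit Defensive.

Import Order.TTheory GRing.Theory Num.Theory.
Local Open Scope ring_scope.

(* The vertex set {1, ..., n} is represented by 'I_n. *)
Record valued_cluster_quiver (n : nat) := ValuedClusterQuiver {
  arrow : finType;
  src : arrow -> 'I_n;
  tgt : arrow -> 'I_n;
  valuation : arrow -> nat * nat;
  no_loop : forall a, src a != tgt a;
  (* unordered pairs of vertices, so this excludes oriented 2-cycles as well *)
  no_multiple_arrow : injective (fun a => [set src a; tgt a]);
  valuation_gt0 : forall a, (0 < (valuation a).1)%N /\ (0 < (valuation a).2)%N;
  symmetrizable : exists d : 'I_n -> nat,
    (forall i, (0 < d i)%N) /\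
    (forall a, (d (src a) * (valuation a).1 = d (tgt a) * (valuation a).2)%N)
}.

Section QuiverTheory.

Variables (n : nat) (Q : valued_cluster_quiver n).

Definition from_to (i j : 'I_n) : pred (arrow Q) :=
  [pred a | (src a == i) && (tgt a == j)].

(* [v_ i j] is the first component of the value of an arrow i -> j, or the
   second component of the value of an arrow j -> i; it is used only when one
   of these arrows exists, and is 0 by convention otherwise. *)
Definition v_ (i j : 'I_n) : nat :=
  if [pick a | from_to i j a] is Some a then (valuation a).1
  else if [pick a | from_to j i a] is Some a then (valuation a).2
  else 0%N.

Definition exchange_matrix : 'M[int]_n :=
  \matrix_(i, j)
    if [exists a, from_to i j a] then (v_ i j)%:Z
    else if [exists a, from_to j i a] then - (v_ i j)%:Z
    else 0.

Definition adjacency_matrix : 'M[int]_n :=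
  \matrix_(i, j) Num.max (exchange_matrix i j) 0.

(* The target of each arrow is the source of the next one, cyclically. *)
Definition is_cycle (k : nat) (c : k.-tuple (arrow Q)) : bool :=
  cycle (fun a b => tgt a == src b) c.

Definition acyclic : Prop :=
  forall (k : nat) (c : k.-tuple (arrow Q)), (1 <= k)%N -> ~~ is_cycle c.

End QuiverTheory.

Definition principal_minor (R : comPzRingType) (n : nat) (A : 'M[R]_n)
    (I : {set 'I_n}) : R :=
  \det (mxsub (fun k : 'I_#|I| => enum_val k) (fun k : 'I_#|I| => enum_val k) A).

(* Main.v *)
Require Import Defs.
From mathcomp Require Import all_boot all_order all_algebra.

Set Implicit Arguments.
Unset Strict Implicit.
Unset Printing Implicit Defensive.

Import Order.TTheory GRing.Theory Num.Theory.
Local Open Scope ring_scope.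

(** Acyclicity is read off the support of the adjacency matrix [A] through one
combinatorial notion: a nonempty set [I] of vertices is _sink-free_ if every
vertex of [I] has a successor in [I].  A finite quiver has an oriented cycle
exactly when it has a sink-free set ([acyclicP]): the vertices of a cycle form
one, and inside a sink-free set a walk can be continued forever, hence
eventually closes up.  The three properties are then compared with the
existence of a sink-free set.

- If the principal minor on [I] is nonzero, no row of the submatrix vanishes,
  so [I] is sink-free.  Conversely, let [I] be minimal among the sink-free sets.
  The image of [I] under any choice of successors in [I] is again sink-free,
  hence is [I], so that every such choice is injective.  It follows that every
  row of the submatrix on [I] has an entry that is alone in its column, which
  makes the minor nonzero ([minimal_sink_free_minor_neq0]).

- If [A w = a w] with [a] and [w] nonzero, then the support of [w] is sink-free.
  Conversely, if all eigenvalues vanish then [A] is nilpotent by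
  Cayley-Hamilton.  But the entries of [A] are nonnegative integers, so for [I]
  sink-free the indicator vector [u] of [I] satisfies [u <= A u], hence
  [u <= A^m u] for all [m], which is incompatible with nilpotency
  ([sink_free_expr_neq0]). *)

(** * Cycles in finite relations *)

(** An endless walk in a finite type revisits a point, and the part of the walk
between the two visits is a cycle. *)
Lemma exists_cycle (T : finType) (e : rel T) (P : pred T) (x0 : T) :
  P x0 -> (forall x, P x -> exists2 y, P y & e x y) ->
  exists2 c : seq T, (0 < size c)%N & cycle e c.
Proof.
move=> Px0 next_e.
pose f x := odflt x [pick y | P y && e x y].
have fP x : P x -> P (f x) && e x (f x).
  move=> Px; rewrite /f; case: pickP => //= noy.
  by have [y Py exy] := next_e x Px; move: (noy y); rewrite /= Py exy.
have iterP m : P (iter m f x0).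
  by elim: m => //= m IHm; case/andP: (fP _ IHm).
have /trajectP[i lt_i eq_i] := looping_order f x0.
set y := iter i f x0 in eq_i.
have [p def_p] : exists p, fingraph.order f x0 = (p.+1 + i)%N.
  by exists (fingraph.order f x0 - i.+1)%N; rewrite addSnnS subnK.
have yK : iter p.+1 f y = y by rewrite -iterD -def_p.
exists (traject f y p.+1); first by rewrite size_traject.
have fcy : fcycle f (traject f y p.+1).
  by rewrite trajectS /= rcons_path fpath_traject last_traject /= -iterS yK.
apply: (@sub_in_cycle _ P (frel f)) fcy => [x z Px _ /= /eqP <-|].
  by case/andP: (fP x Px).
apply/allP=> z /trajectP[j _ ->].
by rewrite /y -iterD iterP.
Qed.

(** * Sink-free sets of a matrix *)

Section SinkFree.

Variables (R : nzRingType) (n : nat).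
Implicit Types (A : 'M[R]_n) (I : {set 'I_n}).

Definition sink_free A I : bool :=
  (I != set0) && [forall i in I, [exists j in I, A i j != 0]].

Lemma sink_freeP A I :
  reflect (I != set0 /\ forall i, i \in I -> exists2 j, j \in I & A i j != 0)
          (sink_free A I).
Proof.
apply: (iffP andP) => -[I0 sI]; split=> //.
  by move=> i Ii; move/forall_inP: sI => /(_ i Ii) /exists_inP.
by apply/forall_inP=> i Ii; apply/exists_inP; apply: sI.
Qed.

(** The image of [I] under a choice of successors is again sink-free, since the
choice sends it to itself; so minimality makes the choice a bijection. *)
Lemma minimal_sink_free_inj A I (h : 'I_n -> 'I_n) :
    minset (sink_free A) I ->
    (forall i, i \in I -> (h i \in I) && (A i (h i) != 0)) ->
  {in I &, injective h}.
Proof.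
move=> /minsetP[/sink_freeP[I0 _] minI] hP.
have hI : h @: I \subset I.
  by apply/subsetP=> _ /imsetP[i Ii ->]; case/andP: (hP i Ii).
apply/imset_injP/eqP; congr #|pred_of_set _|; apply: minI => //.
apply/sink_freeP; split.
  by case/set0Pn: I0 => i Ii; apply/set0Pn; exists (h i); apply: imset_f.
move=> _ /imsetP[i Ii ->]; case/andP: (hP i Ii) => hiI _.
by exists (h (h i)); [apply: imset_f | case/andP: (hP _ hiI)].
Qed.

(** A successor [l] of [k] in [I] shared with another [k'] in [I] would allow a
choice of successors that sends both [k] and [k'] to [l]. *)
Lemma minimal_sink_free_private A I k :
    minset (sink_free A) I -> k \in I ->
  exists l, [/\ l \in I, A k l != 0
    & forall k', k' \in I -> A k' l != 0 -> k' = k].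
Proof.
move=> minI Ik; have /sink_freeP[_ sI] := minsetp minI.
pose g i := odflt i [pick j in I | A i j != 0].
have gP i : i \in I -> (g i \in I) && (A i (g i) != 0).
  move=> Ii; rewrite /g; case: pickP => //= noj.
  by have [j Ij Aij] := sI i Ii; move: (noj j); rewrite Ij Aij.
case/andP: (gP k Ik) => Igk Akgk; exists (g k); split=> // k' Ik' Ak'.
pose h i := if i == k' then g k else g i.
apply: (@minimal_sink_free_inj A I h) => //; last by rewrite /h eqxx if_same.
by move=> i Ii; rewrite /h; case: eqP => [->|_]; rewrite ?Igk ?gP.
Qed.

End SinkFree.

(** * Principal minors *)

(** A nonzero vector in the left kernel is contradicted in the column of the
private entry of a row that carries a nonzero coefficient. *)
Lemma det_private_entries_neq0 (R : idomainType) (m : nat) (B : 'M[R]_m) :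
    (forall k, exists2 l, B k l != 0 & forall k', B k' l != 0 -> k' = k) ->
  \det B != 0.
Proof.
move=> privB; apply/det0P=> -[v /rV0Pn[k vk0] vB0].
have [l Bkl Bl] := privB k.
have /eqP := congr1 (fun w : 'rV_m => w 0 l) vB0.
rewrite !mxE (bigD1 k) //= big1 ?addr0; first by rewrite mulf_eq0 (negPf vk0) (negPf Bkl).
move=> k' /eqP k'k; have [->|/Bl] := eqVneq (B k' l) 0; first by rewrite mulr0.
by [].
Qed.

Lemma minimal_sink_free_minor_neq0 (R : idomainType) (n : nat) (A : 'M[R]_n)
    (I : {set 'I_n}) :
  minset (sink_free A) I -> principal_minor A I != 0.
Proof.
move=> minI; apply: det_private_entries_neq0 => k.
have [l [Il Akl privl]] := minimal_sink_free_private minI (enum_valP k).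
exists (enum_rank_in Il l); rewrite ?mxE ?enum_rankK_in // => k'.
rewrite mxE enum_rankK_in // => Ak'l; apply: enum_val_inj.
by apply: privl => //; apply: enum_valP.
Qed.

Lemma principal_minor_sink_free (R : comNzRingType) (n : nat) (A : 'M[R]_n)
    (I : {set 'I_n}) :
  I != set0 -> principal_minor A I != 0 -> sink_free A I.
Proof.
move=> I0 minor_neq0; apply/sink_freeP; split=> // i Ii.
apply/exists_inP; apply: contraNT minor_neq0 => /exists_inPn noj.
rewrite /principal_minor (expand_det_row _ (enum_rank_in Ii i)) big1 // => k _.
rewrite mxE enum_rankK_in //.
by have /negPn/eqP-> := noj _ (enum_valP k); rewrite mul0r.
Qed.

Lemma principal_minors_eq0P (R : idomainType) (n : nat) (A : 'M[R]_n) :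
  (forall I, ~~ sink_free A I) <->
  (forall I : {set 'I_n}, I != set0 -> principal_minor A I = 0).
Proof.
split=> [nosf I I0|minor0 I].
  by apply/eqP; apply: contraNT (nosf I); apply: principal_minor_sink_free.
apply/negP=> /minset_exists[J minJ _].
have /sink_freeP[J0 _] := minsetp minJ.
by have := minimal_sink_free_minor_neq0 minJ; rewrite minor0 ?eqxx.
Qed.

(** * Eigenvalues *)

Lemma eigenvalue_trmx (F : fieldType) (n : nat) (A : 'M[F]_n) (a : F) :
  eigenvalue A^T a = eigenvalue A a.
Proof.
rewrite !eigenvalue_root_char /char_poly -[in RHS]det_tr.
congr (root (\det _) a); apply/matrixP=> i j.
by rewrite !mxE eq_sym.
Qed.

(** The support of a right eigenvector [w] works: in [a w_i = \sum_j A_ij w_j]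
the left-hand side is nonzero, so some term on the right is. *)
Lemma eigenvalue_sink_free (F : fieldType) (n : nat) (A : 'M[F]_n) (a : F) :
  eigenvalue A a -> a != 0 -> exists I, sink_free A I.
Proof.
rewrite -eigenvalue_trmx => /eigenvalueP[v vA v0] a0.
exists [set i | v 0 i != 0]; apply/sink_freeP; split.
  by have /rV0Pn[i vi] := v0; apply/set0Pn; exists i; rewrite inE.
move=> i; rewrite inE => vi.
have avi : (v *m A^T) 0 i != 0 by rewrite vA mxE mulf_neq0.
apply/exists_inP; apply: contraNT avi => /exists_inPn noj.
rewrite mxE big1 // => j _; rewrite mxE.
have [->|vj] := eqVneq (v 0 j) 0; first by rewrite mul0r.
by have /negPn/eqP-> : ~~ (A i j != 0); [apply: noj; rewrite inE | rewrite mulr0].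
Qed.

(** The characteristic polynomial splits with all its roots zero, so it is a
power of the variable, and Cayley-Hamilton applies. *)
Lemma eigenvalues0_nilpotent (F : closedFieldType) (n : nat) (A : 'M[F]_n.+1) :
  (forall a, eigenvalue A a -> a = 0) -> exists m, A ^+ m = 0.
Proof.
move=> ev0; have [r def_p] := closed_field_poly_normal (char_poly A).
rewrite (monicP (char_poly_monic A)) scale1r in def_p.
have r0 z : z \in r -> z = 0.
  by move=> rz; apply: ev0; rewrite eigenvalue_root_char def_p root_prod_XsubC.
exists (size r).
have := Cayley_Hamilton A; rewrite def_p.
rewrite (eq_big_seq (fun=> 'X)) => [|z /r0->]; last by rewrite subr0.
by rewrite big_const_seq count_predT iter_mulr_1 rmorphXn /= horner_mx_X.
Qed.

(** The indicator vector [u] of [I] satisfies [u <= A *m u], and multiplication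
by the nonnegative matrix [A] preserves this inequality. *)
Lemma sink_free_expr_neq0 (n : nat) (A : 'M[int]_n.+1) (I : {set 'I_n.+1})
    (m : nat) :
  (forall i j, 0 <= A i j) -> sink_free A I -> A ^+ m != 0.
Proof.
move=> A0 /sink_freeP[/set0Pn[i0 Ii0] sI].
pose u : 'cV[int]_n.+1 := \col_i (i \in I)%:R.
have uA k i : u i 0 <= (A ^+ k *m u) i 0.
  elim: k i => [|k IHk] i; first by rewrite expr0 mul1mx.
  rewrite exprS -[(A * _)%R]/(A *m _) -mulmxA mxE.
  have term0 j : 0 <= A i j * (A ^+ k *m u) j 0.
    by rewrite mulr_ge0 // (le_trans _ (IHk j)) // mxE ler0n.
  rewrite mxE; have [/sI[j Ij Aij]|_] := boolP (i \in I); last exact: sumr_ge0.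
  rewrite (bigD1 j) //= -[1%:R]addr0 lerD ?sumr_ge0 //.
  rewrite -[1%:R]mulr1 ler_pM ?ler01 //.
    by rewrite -gtz0_ge1 lt0r Aij A0.
  by apply: le_trans (IHk j); rewrite mxE Ij.
apply/eqP=> Am0; have := uA m i0.
by rewrite Am0 mul0mx !mxE Ii0.
Qed.

Lemma sink_free_map_intr (R : numDomainType) (n : nat) (A : 'M[int]_n)
    (I : {set 'I_n}) :
  sink_free (map_mx (intr : int -> R) A) I = sink_free A I.
Proof.
congr (_ && _); apply: eq_forallb => i; congr (_ ==> _).
by apply: eq_existsb => j; rewrite mxE intr_eq0.
Qed.

Lemma eigenvalues_eq0P (C : numClosedFieldType) (n : nat) (A : 'M[int]_n) :
    (forall i j, 0 <= A i j) ->
  (forall I, ~~ sink_free A I) <->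
  (forall a : C, eigenvalue (map_mx (intr : int -> C) A) a -> a = 0).
Proof.
move=> A0; split=> [nosf a evA|ev0 I].
  apply/eqP/negPn/negP=> /(eigenvalue_sink_free evA)[I].
  by rewrite sink_free_map_intr (negPf (nosf I)).
apply/negP; case: n A A0 I ev0 => [|n] A A0 I ev0 sfI.
  by have /sink_freeP[/set0Pn[[]]] := sfI.
have [m /eqP] := eigenvalues0_nilpotent ev0.
rewrite -(rmorphXn (map_mx (intr : int -> C))) => Am0.
have /eqP[] := sink_free_expr_neq0 m A0 sfI.
apply/matrixP=> i j; apply/eqP; rewrite mxE -(intr_eq0 C).
by move/eqP/matrixP/(_ i j): Am0; rewrite !mxE => ->.
Qed.

(** * Quivers *)

Section Quiver.

Variables (n : nat) (Q : valued_cluster_quiver n).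

Lemma adjacency_matrix_ge0 (i j : 'I_n) : 0 <= adjacency_matrix Q i j.
Proof. by rewrite mxE le_max lexx orbT. Qed.

Lemma adjacency_matrix_neq0 (i j : 'I_n) :
  (adjacency_matrix Q i j != 0) = [exists a : arrow Q, from_to i j a].
Proof.
rewrite !mxE; have [/existsP[a ija]|_] :=
  boolP [exists a : arrow Q, from_to i j a]; last first.
  by case: ifP => _; rewrite max_r ?eqxx // oppr_le0.
have v_gt0 : (0 < v_ Q i j)%N.
  rewrite /v_; case: pickP => [b _|noa]; last by rewrite noa in ija.
  by case: (valuation_gt0 b).
by rewrite max_l // -lt0n.
Qed.

(** In a sink-free set every arrow that ends in the set can be followed by
another one, which gives a cycle; and the sources of the arrows of a cycle form
a sink-free set. *)
Lemma acyclicP :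
  acyclic Q <-> forall I, ~~ sink_free (adjacency_matrix Q) I.
Proof.
split=> [acQ I|nosf k c k_gt0].
  apply/negP=> /sink_freeP[/set0Pn[i0 Ii0] sI].
  have out i : i \in I -> exists2 a : arrow Q, tgt a \in I & src a = i.
    move=> /sI[j Ij]; rewrite adjacency_matrix_neq0 => /existsP[a].
    by case/andP=> /eqP srca /eqP tgta; exists a; rewrite ?tgta.
  have [a0 Ia0 _] := out i0 Ii0.
  have [a /out[b Ib <-]|c c_gt0 cyc] :=
    @exists_cycle _ (fun a b => tgt a == src b) (fun a => tgt a \in I) a0 Ia0.
    by exists b.
  by have /negP[] := acQ _ (in_tuple c) c_gt0.
apply/negP=> cyc; have /negP[] := nosf [set src a | a in tval c].
apply/sink_freeP; split.
  case: k c k_gt0 cyc => // k c _ _.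
  by apply/set0Pn; exists (src (thead c)); apply/imset_f/mem_tnth.
move=> _ /imsetP[a ca ->].
exists (src (next c a)); first by apply: imset_f; rewrite mem_next.
rewrite adjacency_matrix_neq0; apply/existsP; exists a.
by apply/andP; split; [exact: eqxx | exact: next_cycle cyc ca].
Qed.

End Quiver.

Theorem proposition2p6 (C : numClosedFieldType) (n : nat)
    (Q : valued_cluster_quiver n) :
  (acyclic Q <->
     (forall I : {set 'I_n}, I != set0 ->
        principal_minor (adjacency_matrix Q) I = 0)) /\
  (acyclic Q <->
     (forall a : C,
        eigenvalue (map_mx (intr : int -> C) (adjacency_matrix Q)) a -> a = 0)).
Proof.
split; apply: (iff_trans (acyclicP Q)).
  exact: principal_minors_eq0P.
exact: eigenvalues_eq0P (adjacency_matrix_ge0 Q).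
Qed.
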